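(* Let $d\ge2$ and let $q_1,\dots,q_d\ge 2$ be integers that do not all coincide. Then $\mathrm{Aut}(\mathrm{DL}(q_1,\dots,q_d))$ (the graph automorphism group with the topology of pointwise convergence) does not possess any co-compact lattice. In particular, $\mathrm{DL}(q_1,\dots,q_d)$ cannot be the Cayley graph of a finitely generated group.
   Context: For an integer $q\ge 2$, $\mathbb T_q$ is the homogeneous tree in which every vertex has $q+1$ neighbours, with graph metric $d(\cdot,\cdot)$, a fixed origin $o$ and a fixed end $\omega$ (an end is a class of one-sided infinite geodesic rays, two rays being equivalent if their symmetric difference is finite). Let $x\curlywedge y$ be the maximal common ancestor of $x,y$, i.e. the first common vertex of the geodesic rays from $x$ and from $y$ that represent $\omega$. The Busemann function is $\mathfrak h(x)=d(x,x\curlywedge o)-d(o,x\curlywedge o)$. With $T_j=\mathbb T_{q_j}$, the Diestel-Leader graph $\mathrm{DL}(q_1,\dots,q_d)$ has vertex set $\{x_1\cdots x_d\in T_1\times\dots\times T_d:\ \mathfrak h(x_1)+\dots+\mathfrak h(x_d)=0\}$, and $x_1\cdots x_d$, $y_1\cdots y_d$ are neighbours iff there are $i\ne j$ such that $x_i\sim y_i$ in $T_i$, $x_j\sim y_j$ in $T_j$, and $x_k=y_k$ for all $k\ne i,j$. A co-compact lattice in a locally compact group is a discrete, countable subgroup such that the factor space is compact. For a finitely generated group $\Gamma$ and a finite generating set $S=S^{-1}$, the Cayley graph $X(\Gamma,S)$ has vertex set $\Gamma$ and edges $[x,y]$ for all $x,y\in\Gamma$ with $x^{-1}y\in S$. 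*)

(* Defs.v *)
From HB Require Import structures.
From mathcomp Require Import all_boot all_order all_algebra finmap.
From mathcomp Require Import all_classical topology.

Set Implicit Arguments.
Unset Strict Implicit.
Unset Printing Implicit Defensive.

Local Open Scope classical_set_scope.
Local Open Scope card_scope.
Local Open Scope quotient_scope.
Local Open Scope group_scope.

(* A graph is given by its adjacency relation, a rel on a choiceType. *)

Section Graphs.
Variables V W : choiceType.

Definition is_graph_iso (e : rel V) (e' : rel W) (f : V -> W) : Prop :=
  bijective f /\ {mono f : x y / e x y >-> e' x y}.

Definition isomorphic_graphs (e : rel V) (e' : rel W) : Prop :=
  exists f : V -> W, is_graph_iso e e' f.

Variable e : rel V.

Definition connected_graph : Prop :=
  forall x y, exists2 p, path e x p & last x p = y.

(* In a symmetric loopless relation, the only repetition-free closed walks of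
   length at most 2 are the empty one and the back-and-forth ones along an
   edge; the others are the cycles of the graph. *)
Definition acyclic_graph : Prop := forall c, ucycle e c -> (size c <= 2)%N.

Definition is_tree : Prop :=
  [/\ symmetric e, irreflexive e, connected_graph & acyclic_graph].

Definition homogeneous_tree (q : nat) : Prop :=
  is_tree /\ forall x, [set y | e x y] #= `I_q.+1.

Definition walk_length (x y : V) : set nat :=
  [set n | exists p, [/\ path e x p, last x p = y & size p = n]].

(* The graph metric; the value 0 is a dummy if x and y are not connected. *)
Definition gdist (x y : V) : nat :=
  xget 0%N [set n | walk_length x y n /\ lbound (walk_length x y) n].

Definition geodesic_ray (r : nat -> V) : Prop :=
  forall m n, (m <= n)%N -> gdist (r m) (r n) = (n - m)%N.

Definition ray_equiv (r s : nat -> V) : Prop :=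
  finite_set ((range r `\` range s) `|` (range s `\` range r)).

Definition is_end (w : set (nat -> V)) : Prop :=
  exists2 r, geodesic_ray r & w = [set s | geodesic_ray s /\ ray_equiv r s].

End Graphs.

(* A copy of the homogeneous tree of degree q + 1 with a reference vertex and a
   reference end; an end is represented by the set of its rays. *)
Record ended_tree (q : nat) := EndedTree {
  vertex :> choiceType;
  tadj : rel vertex;
  origin : vertex;
  tend : set (nat -> vertex);
  tadj_homogeneous : homogeneous_tree tadj q;
  tend_is_end : is_end tadj tend
}.

Section Horocycles.
Variables (q : nat) (T : ended_tree q).
Implicit Types x y z : T.

(* In a tree, each vertex is the start of exactly one ray of a given end, and
   the rays of an end from two vertices meet: the defaults of xget are dummies
   in the two definitions below. *)
Definition ray_from x : nat -> T :=
  xget (fun=> x) [set r | tend r /\ r 0%N = x].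

Definition is_first_common x y z : Prop :=
  exists m n, [/\ ray_from x m = z, ray_from y n = z &
    forall i j, ray_from x i = ray_from y j -> (m <= i)%N /\ (n <= j)%N].

Definition confluent x y : T := xget x [set z | is_first_common x y z].

Definition busemann x : int :=
  ((gdist (@tadj q T) x (confluent x (origin T)))%:Z -
   (gdist (@tadj q T) (origin T) (confluent x (origin T)))%:Z)%R.

End Horocycles.

Section DiestelLeader.
Variables (d : nat) (q : 'I_d -> nat) (T : forall i, ended_tree (q i)).

Definition DL_vertex :=
  {x : {dffun forall i, T i} | (\sum_i busemann (x i))%R == 0%R}.

HB.instance Definition _ := Choice.on DL_vertex.

Definition DL_adj : rel DL_vertex := fun x y =>
  [exists i, exists j,
    [&& i != j, tadj (val x i) (val y i), tadj (val x j) (val y j) &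
        [forall k, (k != i) && (k != j) ==> (val x k == val y k)]]].

End DiestelLeader.

Section Automorphisms.
Variables (V : choiceType) (e : rel V).

Definition graph_aut := {f : V -> V | `[< is_graph_iso e e f >]}.

HB.instance Definition _ := Choice.on graph_aut.

Implicit Types f g h : graph_aut.

Lemma graph_autP f : is_graph_iso e e (val f).
Proof. exact/asboolP/(valP f). Qed.

Lemma graph_aut_one_subproof : `[< is_graph_iso e e id >].
Proof. by apply/asboolP; split=> //; exists id. Qed.

Lemma graph_aut_mul_subproof f g : `[< is_graph_iso e e (val f \o val g) >].
Proof.
have [[bf mf] [bg mg]] := (graph_autP f, graph_autP g).
by apply/asboolP; split; [exact: bij_comp | move=> x y; rewrite /= mf mg].
Qed.

Definition graph_aut_inv_fun f : V -> V :=
  xget (@id V) [set g | cancel (val f) g /\ cancel g (val f)].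

Lemma graph_aut_invK f :
  cancel (val f) (graph_aut_inv_fun f) /\ cancel (graph_aut_inv_fun f) (val f).
Proof.
have [[g fK gK] _] := graph_autP f.
by rewrite /graph_aut_inv_fun; case: xgetP => [h _ //|/(_ g)[]].
Qed.

Lemma graph_aut_inv_subproof f : `[< is_graph_iso e e (graph_aut_inv_fun f) >].
Proof.
have [fK gK] := graph_aut_invK f; have [_ mf] := graph_autP f.
apply/asboolP; split; first by exists (val f).
by move=> x y; rewrite -mf !gK.
Qed.

Definition graph_aut_one : graph_aut := exist _ id graph_aut_one_subproof.
Definition graph_aut_mul f g : graph_aut :=
  exist _ (val f \o val g) (graph_aut_mul_subproof f g).
Definition graph_aut_inv f : graph_aut :=
  exist _ (graph_aut_inv_fun f) (graph_aut_inv_subproof f).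

Lemma graph_aut_mulA : associative graph_aut_mul.
Proof. by move=> f g h; apply/val_inj. Qed.

Lemma graph_aut_mul1 : left_id graph_aut_one graph_aut_mul.
Proof. by move=> f; apply/val_inj. Qed.

Lemma graph_aut_mulr1 : right_id graph_aut_one graph_aut_mul.
Proof. by move=> f; apply/val_inj. Qed.

Lemma graph_aut_mulV : left_inverse graph_aut_one graph_aut_inv graph_aut_mul.
Proof.
by move=> f; apply/val_inj/funext => x /=; rewrite (graph_aut_invK f).1.
Qed.

Lemma graph_aut_mulrV : right_inverse graph_aut_one graph_aut_inv graph_aut_mul.
Proof.
by move=> f; apply/val_inj/funext => x /=; rewrite (graph_aut_invK f).2.
Qed.

HB.instance Definition _ := isGroup.Build graph_aut graph_aut_mulA
  graph_aut_mul1 graph_aut_mulr1 graph_aut_mulV graph_aut_mulrV.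

(* Topology of pointwise convergence, the vertex set being discrete. *)
HB.instance Definition _ := Topological.copy graph_aut
  (initial_topology (val : graph_aut -> {ptws V -> discrete_topology V})).

End Automorphisms.

Section LeftCosets.
Variables (G : groupType) (H : groupClosed G).

Definition lcoset_rel : rel G := fun x y => x^-1 * y \in H.

Lemma lcoset_rel_refl : reflexive lcoset_rel.
Proof. by move=> x; rewrite /lcoset_rel mulVg gpred1. Qed.

Lemma lcoset_rel_sym : symmetric lcoset_rel.
Proof. by move=> x y; rewrite /lcoset_rel -gpredV invgM invgK. Qed.

Lemma lcoset_rel_trans : transitive lcoset_rel.
Proof.
move=> y x z Hxy Hyz.
by have := gpredM _ _ Hxy Hyz; rewrite -mulgA mulVKg.
Qed.

Canonical lcoset_equiv :=
  EquivRel lcoset_rel lcoset_rel_refl lcoset_rel_sym lcoset_rel_trans.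

Definition lcosets := {eq_quot lcoset_equiv}.

End LeftCosets.

Section Lattices.
Variables (V : choiceType) (e : rel V) (H : groupClosed (graph_aut e)).

(* set_type carries the subspace topology. *)
Definition discrete_subgroup : Prop :=
  forall A : set (set_type [set` H]), open A.

Definition factor_space := quotient_topology (lcosets H).

Definition cocompact_lattice : Prop :=
  [/\ discrete_subgroup, countable [set` H] & compact [set: factor_space]].

End Lattices.

Section Cayley.
Variables (G : groupType) (S : {fset G}).

Definition symmetric_subset : Prop := forall x, (x^-1 \in S) = (x \in S).

Definition generates : Prop :=
  forall H : groupClosed G, {subset S <= H} -> forall x, x \in H.

Definition cayley_adj : rel G := fun x y => x^-1 * y \in S.

End Cayley.

(* Main.v *)
Require Import Defs.
From mathcomp Require Import all_boot all_order all_algebra finmap.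
From mathcomp Require Import all_classical topology.
From mathcomp Require Import zify.

(** The graph DL is vertex-transitive but not unimodular.  An edge from x to y
    goes up in one tree u (y_u is the neighbour of x_u towards the end) and down
    in another tree v, so x has q_v outgoing and q_u incoming edges of type
    (u, v).  As the q_i do not all coincide, the edges of the types with q_u < q_v
    form a relation whose constant out-degree exceeds its constant in-degree.

    That relation is invariant under all automorphisms, because it can be read
    off the graph.  Two vertices that differ in one coordinate, where they have
    the same predecessor, are siblings; distinct siblings are recognized among
    the non-adjacent pairs by having at least 2 (d - 1) common neighbours
    ([twin_sibling]).  An edge of type (u, v) from x to y has q_u siblings of x
    adjacent to y and q_v siblings of y adjacent to x, x and y themselves being
    counted ([sibling_nbrs]).  So q_u < q_v is a property of the graph
    ([biasedE]).

    If a group acts on a set with finitely many orbits and finite stabilizers,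
    then counting an invariant relation from both ends, each orbit weighted by
    the inverse of the order of a stabilizer, shows that constant out- and
    in-degrees agree ([mass_transport]).  Therefore no group of automorphisms of
    DL has finitely many orbits and finite stabilizers ([no_cofinite_action]).

    A group whose Cayley graph is DL would act in this way by left translations.
    So would a co-compact lattice: since the full automorphism group is
    transitive ([DL_transitive]), compactness of the factor space leaves finitely
    many orbits ([cocompact_orbits]); and since DL is connected and locally
    finite, discreteness makes the stabilizers finite
    ([discrete_finite_stabilizer]). *)

Set Implicit Arguments.
Unset Strict Implicit.
Unset Printing Implicit Defensive.

(** * Simple paths and rays in trees *)
Section Trees.
Variables (V : choiceType) (e : rel V).
Hypothesis treeV : is_tree e.

Let e_sym : symmetric e. Proof. by case: treeV. Qed.
Let e_irr : irreflexive e. Proof. by case: treeV. Qed.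
Let e_acyc : acyclic_graph e. Proof. by case: treeV. Qed.

(** A simple path inside such a walk, closed up through x, would be a cycle of
    length at least 3. *)
Lemma tree_no_detour x a b s : e x a -> e x b -> a != b ->
  path e a s -> last a s = b -> x \notin a :: s -> False.
Proof.
move=> xa xb ab /shortenP[p ep up sp] lp xs.
have xp : x \notin a :: p.
  apply: contra xs; rewrite !inE => /orP[->//|/sp ->]; exact: orbT.
have /e_acyc : ucycle e (x :: a :: p).
  rewrite /ucycle /= xa rcons_path ep /= lp e_sym xb /=.
  by move: up xp => /= -> ->.
by case: p lp {ep up sp xp} => [/= ab'|//]; rewrite ab' eqxx in ab.
Qed.

Lemma rev_path_end b s : path e b s ->
  path e (last b s) (rev (belast b s)) /\ last (last b s) (rev (belast b s)) = b.
Proof.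
move=> ebs; split; last by case: s {ebs} => //= c s; rewrite rev_cons last_rcons.
by rewrite rev_path (eq_path (e' := e)) // => u v; rewrite e_sym.
Qed.

(** If the paths part at some vertex, one of them followed by the reverse of the
    other is a walk between two neighbours of that vertex that avoids it. *)
Lemma tree_uniq_path x s t : path e x s -> uniq (x :: s) ->
  path e x t -> uniq (x :: t) -> last x s = last x t -> s = t.
Proof.
elim: s x t => [|a s IHs] x [|b t] //=.
- by move=> _ _ _ /andP[+ _] xl; rewrite {1}xl mem_last.
- by move=> _ /andP[+ _] _ _ xl; rewrite -{1}xl mem_last.
move=> /andP[xa eas] /andP[xs us] /andP[xb ebt] /andP[xt ut] lst.
have [ab|ab] := eqVneq a b.
  by rewrite -ab in ebt ut lst *; congr cons; apply: (IHs a).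
have [rt lt] := rev_path_end ebt.
case: (@tree_no_detour x a b (s ++ rev (belast b t))) => //.
- by rewrite cat_path eas lst.
- by rewrite last_cat lst.
rewrite -cat_cons mem_cat mem_rev negb_or xs /=.
by apply: contra xt => /mem_belast.
Qed.

Lemma gdist_walk x y n : walk_length e x y n -> lbound (walk_length e x y) n ->
  gdist e x y = n.
Proof.
move=> wn ln; rewrite /gdist; case: xgetP => [m _ [wm lm]|/(_ n)[]//].
by apply/eqP; rewrite eqn_leq [X in _ && X]ln // [X in X && _]lm.
Qed.

Lemma gdist_uniq_path x s : path e x s -> uniq (x :: s) ->
  gdist e x (last x s) = size s.
Proof.
move=> es us; apply: gdist_walk; first by exists s.
move=> n [p [ep lp <-]]; case/shortenP: ep lp => p' ep' up' sp' lp'.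
rewrite (tree_uniq_path es us ep' up' (esym lp')) //.
apply: uniq_leq_size; first by case/andP: up'.
exact: sp'.
Qed.

(** In a tree these are exactly the geodesic rays ([geodesic_simple]), and this
    form is easier to extend, shift and compare. *)
Definition simple_ray (r : nat -> V) : Prop :=
  injective r /\ forall n, e (r n) (r n.+1).

Lemma ray_segment r m n : simple_ray r ->
  [/\ path e (r m) [seq r i | i <- iota m.+1 n],
      uniq (r m :: [seq r i | i <- iota m.+1 n]) &
      last (r m) [seq r i | i <- iota m.+1 n] = r (m + n)].
Proof.
move=> [ri re]; split.
- by elim: n m => //= n IHn m; rewrite re IHn.
- by rewrite -(map_cons r m) (map_inj_uniq ri) -[m :: _]/(iota m n.+1) iota_uniq.
- by elim: n m => /= [|n IHn] m; rewrite ?addn0 // IHn addSnnS.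
Qed.

Lemma simple_ray_dist r m n : simple_ray r -> (m <= n)%N ->
  gdist e (r m) (r n) = (n - m)%N.
Proof.
move=> rr mn; have [es us ls] := ray_segment m (n - m) rr.
by rewrite -{1}(subnKC mn) -ls gdist_uniq_path // size_map size_iota.
Qed.

Lemma geodesic_simple r : geodesic_ray e r <-> simple_ray r.
Proof.
split=> [gr|rr m n mn]; last exact: simple_ray_dist.
have inj m n : (m <= n)%N -> r m = r n -> m = n.
  move=> mn rmn; apply/eqP; rewrite eqn_leq mn -subn_eq0 -(gr _ _ mn) rmn.
  by apply/eqP/gdist_walk; [exists [::] | move=> k _].
split=> [m n rmn|n].
  case/orP: (leq_total m n) => mn; first exact: inj.
  by apply/esym/inj.
have := gr n n.+1 (leqnSn n); rewrite subSnn /gdist.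
case: xgetP => [v _ [[p [+ + sv]] _] v1|_ //]; rewrite v1 in sv.
case: p sv => [|y [|]] //= _ + <-.
by rewrite andbT.
Qed.

Lemma ray_shift r k : simple_ray r -> simple_ray (fun n => r (k + n)).
Proof.
by move=> [ri re]; split=> [m n /ri /addnI //|n]; rewrite addnS.
Qed.

Lemma simple_ray_cons x r : simple_ray r -> e x (r 0) -> (forall n, x <> r n) ->
  simple_ray (fun n => if n is k.+1 then r k else x).
Proof.
move=> [ri re] xr xN; split=> [[|m] [|n] //|[|n] //].
- by move/xN.
- by move/esym/xN.
- by move/ri ->.
Qed.

(** If the ray came back to y, its part after r 0 would join two neighbours of
    r 0 without passing through r 0. *)
Lemma ray_avoid r y : simple_ray r -> e y (r 0) -> r 1 <> y ->
  forall n, y <> r n.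
Proof.
move=> rr yr /eqP r1y [|[|n]] yn.
- by rewrite yn e_irr in yr.
- by rewrite yn eqxx in r1y.
have [ep up lp] := ray_segment 1 n.+1 rr.
have := ray_segment 0 n.+2 rr; rewrite /= => -[_ /andP[r0 _] _].
apply: (@tree_no_detour (r 0) (r 1) y _ _ _ r1y ep _ r0).
- by case: rr.
- by rewrite e_sym.
- by rewrite lp yn.
Qed.

(** After the last index up to which they agree the two rays could meet again
    only by a walk around the vertex where they part. *)
Lemma ray_unique r s : simple_ray r -> simple_ray s -> r 0 = s 0 ->
  (forall n, exists k l, (n <= k)%N /\ r k = s l) -> r = s.
Proof.
move=> rr ss rs0 meet; apply/funext; elim/ltn_ind => -[//|n IHn].
have rsn : r n = s n by apply: IHn.
apply/eqP; apply/negP => /negP rsn1.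
have [k [l [nk rkl]]] := meet n.+1.
have nl : (n < l)%N.
  rewrite ltnNge; apply/negP => ln; have := rkl; rewrite -IHn // => /(proj1 rr).
  by move: nk ln; clear; lia.
have [ep up lp] := ray_segment n.+1 (k - n.+1) rr.
have [eq uq lq] := ray_segment n.+1 (l - n.+1) ss.
have := ray_segment n (k - n) rr; have := ray_segment n (l - n) ss.
rewrite -[(l - n)%N]prednK ?subn_gt0 // -[(k - n)%N]prednK ?subn_gt0 //.
rewrite -!subnS => -[_ /andP[sn _] _] [_ /andP[rn _] _].
rewrite subnKC // in lp; rewrite subnKC // in lq.
have [ev lv] := rev_path_end eq.
apply: (@tree_no_detour (r n) (r n.+1) (s n.+1) ([seq r i | i <- iota n.+2 (k - n.+1)] ++
   rev (belast (s n.+1) [seq s i | i <- iota n.+2 (l - n.+1)]))) => //.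
- by case: rr.
- by rewrite rsn; case: ss.
- by rewrite cat_path ep lp rkl -lq.
- by rewrite last_cat lp rkl -lq.
rewrite -cat_cons mem_cat negb_or mem_rev rn /=.
apply: contra sn => /mem_belast; by rewrite rsn.
Qed.

End Trees.

(** * Predecessors and the Busemann function *)
Section Ancestors.
Variables (q : nat) (T : ended_tree q).
Local Notation e := (@tadj q T).
Implicit Types x y z : T.

(** The neighbour of x on the ray from x to the end, the predecessor of x. *)
Definition up x : T := ray_from x 1.

Let treeT : is_tree e. Proof. by case: (tadj_homogeneous T). Qed.
Let e_sym : symmetric e. Proof. by case: treeT. Qed.
Let e_irr : irreflexive e. Proof. by case: treeT. Qed.

Lemma tend_simple (s : nat -> T) : tend s -> simple_ray e s.
Proof.
by have [r _ ->] := tend_is_end T; move=> [/(geodesic_simple treeT)].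
Qed.

(** Arbitrarily late, because only finitely many vertices of s lie outside t. *)
Lemma tend_meet (s t : nat -> T) : tend s -> tend t ->
  forall n, exists k l, (n <= k)%N /\ s k = t l.
Proof.
move=> ws wt n; have [s_inj _] := tend_simple ws.
have /finite_seqP[a ha] : finite_set (range s `\` range t)%classic.
  have [r _ we] := tend_is_end T; rewrite we in ws wt.
  have [[_ fs] [_ ft]] := (ws, wt).
  apply: sub_finite_set (_ : finite_set ((range s `\` range r) `|`
    (range r `\` range t))%classic); last first.
    rewrite finite_setU; split.
      by apply: sub_finite_set fs => v; right.
    by apply: sub_finite_set ft => v; left.
  move=> v [sv tv]; have [rv|rv] := pselect (range r v); by [right|left].
apply: contrapT => no.
have : (size [seq s i | i <- iota n (size a).+1] <= size a)%N.
  apply: uniq_leq_size; first by rewrite map_inj_uniq ?iota_uniq.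
  move=> _ /mapP[k + ->]; rewrite mem_iota => /andP[nk _].
  suff : [set` a]%classic (s k) by [].
  rewrite -ha; split; first by exists k.
  by move=> [l _ lk]; apply: no; exists k, l.
by rewrite size_map size_iota ltnn.
Qed.

Lemma tend_equiv (s t : nat -> T) : tend s -> simple_ray e t ->
  (exists a b, forall n, s (a + n) = t (b + n)) -> tend t.
Proof.
have [r _ we] := tend_is_end T; rewrite we => -[_ fs] st [a [b ab]].
split; first exact/(geodesic_simple treeT).
have fin (f g : nat -> T) c k : (forall n, f (c + n) = g (k + n)) ->
    finite_set (range f `\` range g)%classic.
  move=> fg; apply: sub_finite_set (_ : finite_set [set` [seq f i | i <- iota 0 c]]).
    move=> _ [[n _ <-] gn]; apply/mapP; exists n => //.
    rewrite mem_iota /= add0n ltnNge; apply/negP => cn; apply: gn.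
    by exists (k + (n - c)) => //; rewrite -fg subnKC.
  by apply/finite_seqP; exists [seq f i | i <- iota 0 c].
have fst := fin _ _ _ _ ab; have fts := fin _ _ _ _ (fun n => esym (ab n)).
move: fs; rewrite /ray_equiv !finite_setU => -[f1 f2]; split.
  apply: sub_finite_set (_ : finite_set ((range r `\` range s) `|`
    (range s `\` range t))%classic); last by rewrite finite_setU.
  move=> v [rv tv]; have [sv|sv] := pselect (range s v); by [right|left].
apply: sub_finite_set (_ : finite_set ((range s `\` range r) `|`
    (range t `\` range s))%classic); last by rewrite finite_setU.
move=> v [rv tv]; have [sv|sv] := pselect (range s v); by [left|right].
Qed.

Lemma tend_unique (s t : nat -> T) : tend s -> tend t -> s 0 = t 0 -> s = t.
Proof.
move=> ws wt s0; refine (ray_unique treeT _ _ s0 _); [exact: tend_simple..|exact: tend_meet].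
Qed.

Lemma tend_shift (s : nat -> T) k : tend s -> tend (fun n => s (k + n)).
Proof.
move=> ws; apply: (tend_equiv ws); first exact/ray_shift/tend_simple.
by exists k, 0.
Qed.

(** A ray of the end is moved along an edge, either by dropping its first vertex
    or by prepending the new one; this gives both the existence of rays from all
    vertices and the fact that every edge joins a vertex to its predecessor. *)
Lemma tend_step (s : nat -> T) y : tend s -> e (s 0) y ->
  exists t, [/\ tend t, t 0 = y & s 1 = y \/ t 1 = s 0].
Proof.
move=> ws sy; have [s1|s1] := pselect (s 1 = y).
  by exists (fun n => s (1 + n)); split; [exact: tend_shift| |left].
exists (fun n => if n is k.+1 then s k else y); split=> //; last by right.
apply: (tend_equiv ws); last by exists 0, 1.
have ss := tend_simple ws; apply: simple_ray_cons => //; first by rewrite e_sym.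
by have ys := sy; rewrite e_sym in ys; exact: (ray_avoid treeT ss ys s1).
Qed.

Lemma tend_from x : exists2 s : nat -> T, tend s & s 0 = x.
Proof.
have [r gr we] := tend_is_end T.
have wr : tend r by rewrite we; split=> //; rewrite /ray_equiv !setDv setU0.
case: treeT => _ _ /(_ (r 0) x)[p ep lp] _.
elim: p r {gr we} wr ep lp => [|y p IHp] r wr /=; first by exists r.
case/andP=> ry ep lp; have [t [wt ty _]] := tend_step wr ry.
by apply: (IHp t); rewrite ?ty.
Qed.

Lemma ray_fromP x : tend (ray_from x) /\ ray_from x 0 = x.
Proof.
have [s ws sx] := tend_from x.
by rewrite /ray_from; case: xgetP => [//|/(_ s)[]].
Qed.

Lemma ray_fromE (s : nat -> T) : tend s -> ray_from (s 0) = s.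
Proof. by move=> ws; have [w0 s0] := ray_fromP (s 0); exact: tend_unique. Qed.

Lemma ray_from_iter x n : ray_from x n = iter n up x.
Proof.
elim: n x => [|n IHn] x; first by case: (ray_fromP x).
have [/(tend_shift 1) ws _] := ray_fromP x.
by rewrite iterSr -IHn /up (ray_fromE ws).
Qed.

Lemma iter_up_simple x : simple_ray e (fun n => iter n up x).
Proof.
have -> : (fun n => iter n up x) = ray_from x.
  by apply/funext => n; rewrite ray_from_iter.
by case: (ray_fromP x) => /tend_simple.
Qed.

Lemma tadjE x y : e x y = (up x == y) || (up y == x).
Proof.
apply/idP/orP => [xy|[] /eqP <-]; last by rewrite e_sym; case: (iter_up_simple y) => _ /(_ 0).
  have [ws sx] := ray_fromP x; rewrite -{1}sx in xy.
  have [t [wt ty [|ts]]] := tend_step ws xy; first by left; apply/eqP.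
  by right; rewrite -ty /up ray_fromE // ts sx.
by case: (iter_up_simple x) => _ /(_ 0).
Qed.

Lemma up_meet x y : exists m n, iter m up x = iter n up y.
Proof.
have [wx _] := ray_fromP x; have [wy _] := ray_fromP y.
have [m [n [_]]] := tend_meet wx wy 0.
by rewrite !ray_from_iter; exists m, n.
Qed.

Lemma iter_up_inj x : injective (fun n => iter n up x).
Proof. by case: (iter_up_simple x). Qed.

(** The first common vertex of the two rays may come earlier than the given one,
    but beyond it both rays coincide, which leaves the difference of the
    distances unchanged. *)
Lemma busemannE x m n : iter m up x = iter n up (origin T) ->
  busemann x = (m%:Z - n%:Z)%R.
Proof.
move=> mn; set o := origin T in mn *.
have ex : exists m, `[< exists n, iter m up x = iter n up o >].
  by exists m; apply/asboolP; exists n.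
case: (ex_minnP ex) => a /asboolP[b ab] amin.
have low i j : iter i up x = iter j up o -> (a <= i)%N /\ j = (i - a + b)%N.
  move=> ij; have ai : (a <= i)%N by apply: amin; apply/asboolP; exists j.
  split=> //; apply: (@iter_up_inj o); rewrite /= -ij iterD -ab -iterD subnK //.
have fc z : is_first_common x o z -> z = iter a up x.
  move=> [i [j [iz jz /(_ a b)]]]; rewrite -iz; move: iz jz.
  rewrite !ray_from_iter => <- ij /(_ ab)[ia _]; have [ai _] := low _ _ (esym ij).
  by congr (iter _ up x); apply/eqP; rewrite eqn_leq ia.
have c : confluent x o = iter a up x.
  rewrite /confluent; case: xgetP => [z _ /fc //|/(_ (iter a up x))[]].
  exists a, b; rewrite !ray_from_iter; split=> // i j.
  by rewrite !ray_from_iter => /low[ai ->]; split=> //; exact: leq_addl.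
rewrite /busemann c {2}ab.
rewrite -[in gdist _ x _]/(iter 0 up x) -[in gdist _ o _]/(iter 0 up o).
rewrite !(simple_ray_dist treeT (iter_up_simple _)) // !subn0.
by have [] := low _ _ mn; lia.
Qed.

Lemma busemann_up x : busemann (up x) = (busemann x - 1)%R.
Proof.
have [m [n mn]] := up_meet x (origin T).
rewrite (busemannE mn) (@busemannE (up x) m n.+1); first by lia.
by rewrite -iterSr !iterS mn.
Qed.

Lemma busemann_iter x n : busemann (iter n up x) = (busemann x - n%:Z)%R.
Proof. elim: n => [|n IHn] /=; rewrite ?busemann_up ?IHn; [exact/esym/GRing.subr0 | lia]. Qed.

Lemma busemann_origin : busemann (origin T) = 0%R.
Proof. by rewrite (@busemannE _ 0 0). Qed.

Lemma up_meet_level x y : busemann x = busemann y ->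
  exists n, iter n up x = iter n up y.
Proof.
move=> xy; have [m [n mn]] := up_meet x y; exists n; rewrite -mn.
by congr (iter _ up x); have := congr1 (@busemann q T) mn; rewrite !busemann_iter xy; lia.
Qed.

(** Of the q + 1 neighbours of x all but the predecessor of x are children. *)
Lemma children_exist x :
  exists s : seq T, [/\ uniq s, size s = q & forall y, (y \in s) = (up y == x)].
Proof.
have [_ /(_ x)] := tadj_homogeneous T.
move=> card; pose s := fset_set [set y | e x y]%classic : seq T.
have fin : finite_set [set y | e x y]%classic by apply/finite_setP; exists q.+1.
have sE y : (y \in s) = e x y by rewrite in_fset_set // mem_setE.
have us : uniq s by exact: fset_uniq.
have ss : size s = q.+1 by exact: card_fset_set.
exists (rem (up x) s); rewrite rem_uniq //.
have xs : up x \in s by rewrite sE tadjE eqxx.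
rewrite size_rem // ss; split=> // y; rewrite mem_rem_uniq // !inE sE tadjE.
have [->|] := eqVneq y (up x); last by [].
apply/esym/negbTE/eqP => xx; have := busemann_up (up x); rewrite xx busemann_up.
by lia.
Qed.

Definition children x : seq T := projT1 (cid (children_exist x)).

Lemma childrenP x : [/\ uniq (children x), size (children x) = q &
  forall y, (y \in children x) = (up y == x)].
Proof. by rewrite /children; case: (cid _). Qed.

End Ancestors.

Arguments up {q T} x.

(** * The mass transport principle *)
Section MassTransport.
Variables (G : groupType) (V : choiceType) (act : G -> V -> V) (H : {pred G}).
Local Open Scope group_scope.
Import GRing.Theory Num.Theory.
Hypothesis act1 : forall v, act 1 v = v.
Hypothesis actM : forall g h v, act (g * h) v = act g (act h v).
Hypothesis H1 : 1 \in H.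
Hypothesis HM : forall g h, g \in H -> h \in H -> g * h \in H.
Hypothesis HV : forall g, g \in H -> g^-1 \in H.

Let actK g : cancel (act g) (act g^-1).
Proof. by move=> v; rewrite -actM mulVg act1. Qed.
Let actKV g : cancel (act g^-1) (act g).
Proof. by move=> v; rewrite -actM mulgV act1. Qed.

Definition same_orbit (o v : V) : bool := `[< exists2 g, g \in H & act g o = v >].

Lemma same_orbit_sym u v : same_orbit u v -> same_orbit v u.
Proof.
by move=> /asboolP[g Hg <-]; apply/asboolP; exists g^-1; [exact: HV|exact: actK].
Qed.

Lemma same_orbit_trans u v w : same_orbit u v -> same_orbit v w -> same_orbit u w.
Proof.
move=> /asboolP[g Hg <-] /asboolP[h Hh <-]; apply/asboolP.
by exists (h * g); [exact: HM|rewrite actM].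
Qed.

Lemma orbit_representatives (L : seq V) : exists M : seq V,
  (forall v, has (same_orbit^~ v) L -> has (same_orbit^~ v) M) /\
  pairwise (fun u v => ~~ same_orbit u v) M.
Proof.
elim: L => [|o L [M [cov pw]]]; first by exists [::].
have [hM|hM] := boolP (has (same_orbit^~ o) M).
  exists M; split=> // v /= /orP[ov|/cov//].
  case/hasP: hM => u uM uo; apply/hasP; exists u => //.
  exact: same_orbit_trans uo ov.
exists (o :: M); split=> [v /= /orP[->//|/cov ->]|/=]; first by rewrite orbT.
rewrite pw andbT; apply/allP => u uM; apply: contra hM => ou.
by apply/hasP; exists u => //; exact: same_orbit_sym.
Qed.

Lemma orbit_count_le1 (M : seq V) v : pairwise (fun u v => ~~ same_orbit u v) M ->
  (count (same_orbit^~ v) M <= 1)%N.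
Proof.
elim: M => //= o M IHM /andP[oM /IHM]; case ov: (same_orbit o v) => // _.
rewrite add1n ltnS leqn0 -leqn0 leqNgt -has_count; apply/hasPn => u uM.
apply/negP => uv; have /allP/(_ u uM)/negP := oM; apply.
exact: same_orbit_trans ov (same_orbit_sym uv).
Qed.

Variable stab : V -> seq G.
Hypothesis stab_uniq : forall v, uniq (stab v).
Hypothesis stabP : forall v g, (g \in stab v) = (g \in H) && (act g v == v).

(** The elements of H carrying l to an R-successor of k form a union of left
    cosets of the stabilizer of l, one for each successor in the orbit of l. *)
Lemma count_movers (R : rel V) (out : V -> seq V) (k l : V) :
  uniq (out k) -> (forall y, (y \in out k) = R k y) ->
  exists E : seq G, [/\ uniq E, forall g, (g \in E) = (g \in H) && R k (act g l) &
    size E = (size [seq y <- out k | same_orbit l y] * size (stab l))%N].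
Proof.
move=> uk outk.
pose mv y := xget 1 [set g | g \in H /\ act g l = y].
have mvP y : same_orbit l y -> mv y \in H /\ act (mv y) l = y.
  by move=> /asboolP[g Hg gl]; rewrite /mv; case: xgetP => [//|/(_ g)[]].
pose s := [seq y <- out k | same_orbit l y].
have sP y : y \in s -> mv y \in H /\ act (mv y) l = y.
  by rewrite mem_filter => /andP[/mvP].
exists [seq mv y * g | y <- s, g <- stab l]; split; last by rewrite size_allpairs.
  apply: allpairs_uniq => //; first exact: filter_uniq.
  move=> [y g] [z h] /allpairsP[[y' g'] [/= ys gs [-> ->]]].
  move=> /allpairsP[[z' h'] [/= zs hs [-> ->]]] /= yz.
  have := congr1 (act^~ l) yz; rewrite !actM.
  move: gs hs; rewrite !stabP => /andP[_ /eqP ->] /andP[_ /eqP ->].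
  rewrite (sP _ ys).2 (sP _ zs).2 => eyz; rewrite -eyz in yz *.
  by congr pair; exact: mulgI yz.
move=> g; apply/allpairsP/andP => [[[y h] /= [ys hs ->]]|[Hg Rg]].
  move: hs; rewrite stabP => /andP[Hh /eqP hl]; have [Hy yl] := sP _ ys.
  rewrite actM hl yl -outk; split; first exact: HM.
  by move: ys; rewrite mem_filter => /andP[].
have gs : act g l \in s.
  by rewrite mem_filter outk Rg andbT; apply/asboolP; exists g.
have [Hm ml] := sP _ gs.
exists (act g l, (mv (act g l))^-1 * g) => /=; rewrite mulVKg gs; split=> //.
rewrite stabP HM ?HV //= actM; apply/eqP/(can_inj (actK (mv (act g l)))).
by rewrite actKV ml.
Qed.

(** For representatives k and l of two orbits, inversion is a bijection between
    the group elements g with R k (g l) and those with R (g k) l.  By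
    [count_movers] the two numbers are N k l |stab l| and N' l k |stab k|, where N
    counts the successors of k in the orbit of l and N' the predecessors of l in
    the orbit of k.  Dividing by |stab k| |stab l| and summing over all k and l
    gives a W = b W, where W > 0 is the sum of the weights 1 / |stab k|. *)
Lemma mass_transport (R : rel V) (out inn : V -> seq V) (a b : nat) (L : seq V) (v0 : V) :
  (forall g, g \in H -> forall x y, R x y -> R (act g x) (act g y)) ->
  (forall x, [/\ uniq (out x), size (out x) = a & forall y, (y \in out x) = R x y]) ->
  (forall y, [/\ uniq (inn y), size (inn y) = b & forall x, (x \in inn y) = R x y]) ->
  (forall v, has (same_orbit^~ v) L) -> a = b.
Proof.
move=> RH outP innP /= covL.
have [M [cov pw]] := orbit_representatives L.
have {covL cov}covM v : count (same_orbit^~ v) M = 1%N.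
  by apply/eqP; rewrite eqn_leq orbit_count_le1 // -has_count cov.
pose N k l := size [seq y <- out k | same_orbit l y].
pose N' k l := size [seq y <- inn k | same_orbit l y].
have NN' k l : (N k l * size (stab l) = N' l k * size (stab k))%N.
  have [uk _ mk] := outP k; have [E [uE mE <-]] := count_movers l uk mk.
  have [ul _ ml] := innP l.
  have [F [uF mF <-]] := @count_movers (fun x y => R y x) inn l k ul ml.
  rewrite -(size_map (fun g : G => g^-1)); apply/perm_size/uniq_perm => //.
    by rewrite map_inj_uniq //; exact: invg_inj.
  move=> g; rewrite -[g]invgK (mem_map invg_inj) mE mF invgK.
  apply/andP/andP => -[Hg Rg]; split; rewrite ?invgK ?HV //.
  - by rewrite -[g]invgK; exact: HV.
  - have HgV : g \in H by rewrite -[g]invgK; exact: HV.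
    by rewrite -{1}[l](actKV g); exact: RH.
  - by rewrite -[k](actK g); apply: RH => //; exact: HV.
have split_orbits (s : seq V) : size s = \sum_(l <- M) size [seq y <- s | same_orbit l y].
  under eq_bigr do rewrite size_filter -sum1_count big_mkcond /=.
  rewrite exchange_big /= -sum1_size; apply: eq_bigr => y _.
  by rewrite -big_mkcond sum1_count covM.
have aE k : a = \sum_(l <- M) N k l by have [_ <- _] := outP k; exact: split_orbits.
have bE k : b = \sum_(l <- M) N' k l by have [_ <- _] := innP k; exact: split_orbits.
have s_gt0 k : (0 < size (stab k))%N.
  by rewrite -has_predT; apply/hasP; exists 1; rewrite // stabP H1 act1 eqxx.
(* The weights 1 / |stab k| make N and N' transposes of each other. *)
pose w k : rat := ((size (stab k))%:R^-1)%R.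
have w_gt0 k : (0 < w k)%R by rewrite invr_gt0 ltr0n.
have wN k l : (w k * (N k l)%:R = w l * (N' l k)%:R)%R.
  have := congr1 (fun n => n%:R%R : rat) (NN' k l); rewrite !natrM /w => e.
  have nz m : ((size (stab m))%:R != 0 :> rat)%R by rewrite pnatr_eq0 -lt0n.
  by apply/eqP; rewrite ![(_^-1 * _)%R]mulrC eqr_div // e.
have ab : (a%:R * \sum_(k <- M) w k = b%:R * \sum_(k <- M) w k :> rat)%R.
  rewrite !mulr_sumr (eq_bigr (fun k => \sum_(l <- M) w k * (N k l)%:R)%R); last first.
    by move=> k _; rewrite (aE k) natr_sum mulrC mulr_sumr.
  rewrite exchange_big /=; apply: eq_bigr => l _.
  rewrite (bE l) natr_sum mulrC mulr_sumr; exact: eq_bigr.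
have W : (\sum_(k <- M) w k != 0)%R.
  rewrite Order.POrderTheory.gt_eqF //; case: {aE bE ab pw split_orbits} M covM => [/(_ v0)//|o M _].
  by rewrite big_cons ltr_pwDl // sumr_ge0 // => k _; exact: Order.POrderTheory.ltW.
by apply/eqP; rewrite -(eqr_nat rat); apply/eqP; exact: mulIf ab.
Qed.

End MassTransport.

(** * Edges of the Diestel-Leader graph *)
Section DLsteps.
Variables (d : nat) (q : 'I_d -> nat) (T : forall i, ended_tree (q i)).
Local Notation DLV := (DL_vertex T).
Local Notation e := (@DL_adj d q T).
Local Notation h := (@busemann _ _).
Implicit Types (x y z : DLV) (u v k : 'I_d).

Lemma DL_ext x y : (forall k, val x k = val y k) -> x = y.
Proof. by move=> xy; apply/val_inj/ffunP. Qed.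

Lemma DL_level x : (\sum_i h (val x i) = 0)%R.
Proof. exact/eqP/(valP x). Qed.

Lemma DL_make (f : forall i, T i) : (\sum_i h (f i) = 0)%R ->
  exists x, forall k, val x k = f k.
Proof.
move=> f0; have F0 : (\sum_i h (finfun f i) == 0)%R.
  by rewrite -[X in (_ == X)%R]f0; apply/eqP/eq_bigr => i _; rewrite ffunE.
by exists (exist _ (finfun f) F0) => k; rewrite /= ffunE.
Qed.

Lemma sum_two (f g : 'I_d -> int) u v : u != v ->
  (forall k, k != u -> k != v -> f k = g k) ->
  ((\sum_i f i) + g u + g v = (\sum_i g i) + f u + f v)%R.
Proof.
move=> uv fg; rewrite [in LHS](bigD1 u) //= [in LHS](bigD1 v) 1?eq_sym //=.
rewrite [in RHS](bigD1 u) //= [in RHS](bigD1 v) 1?eq_sym //=.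
rewrite (eq_bigr g) => [|k /andP[ku kv]]; last exact: fg.
lia.
Qed.

Lemma level_two x y u v : u != v ->
  (forall k, k != u -> k != v -> val x k = val y k) ->
  (h (val x u) + h (val x v) = h (val y u) + h (val y v))%R.
Proof.
move=> uv xy; have := @sum_two (fun k => h (val x k)) (fun k => h (val y k)) u v uv.
rewrite !DL_level !GRing.add0r => H.
by rewrite H // => k ku kv; rewrite xy.
Qed.

Lemma level_one x y u : (forall k, k != u -> val x k = val y k) ->
  h (val x u) = h (val y u).
Proof.
move=> xy; have : (\sum_i h (val x i) = \sum_i h (val y i))%R by rewrite !DL_level.
rewrite (bigD1 u) //= [in RHS](bigD1 u) //=.
rewrite (eq_bigr (fun k => h (val y k))) => [|k ku]; last by rewrite xy.
exact: GRing.addIr.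
Qed.

Lemma change_two x u v (a : T u) (b : T v) : u != v ->
  (h a + h b = h (val x u) + h (val x v))%R ->
  exists y, [/\ val y u = a, val y v = b &
    forall k, k != u -> k != v -> val x k = val y k].
Proof.
move=> uv ab; pose f := dfwith (dfwith (val x) u a) v b.
have fu : f u = a by rewrite /f dfwithout 1?eq_sym // dfwithin.
have fv : f v = b by rewrite /f dfwithin.
have fk k : k != u -> k != v -> val x k = f k.
  by move=> ku kv; rewrite /f !dfwithout // eq_sym.
have [|y yf] := @DL_make f.
  have := @sum_two (fun k => h (val x k)) (fun k => h (f k)) u v uv.
  move=> H; have := H (fun k ku kv => congr1 h (fk k ku kv)).
  by rewrite DL_level fu fv; lia.
by exists y; rewrite !yf; split=> // k ku kv; rewrite yf fk.
Qed.

(** An edge of type (u, v): it goes up in tree u and down in tree v.  Its reverse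
    has type (v, u). *)
Definition step u v x y : Prop :=
  [/\ u != v, val y u = up (val x u), up (val y v) = val x v &
      forall k, k != u -> k != v -> val x k = val y k].

Lemma step_level u v x y : step u v x y ->
  forall k, h (val y k) = (h (val x k) + (k == v)%:Z - (k == u)%:Z)%R.
Proof.
move=> [uv yu yv xy] k; have [ku|ku] := eqVneq k u.
  by rewrite ku (negbTE uv) yu busemann_up; lia.
have [->|kv] := eqVneq k v; first by rewrite -yv busemann_up; lia.
by rewrite xy //; lia.
Qed.

Lemma step_uniq u v u' v' x y : step u v x y -> step u' v' x y ->
  u = u' /\ v = v'.
Proof.
move=> s1 s2; have uv : u != v by case: s1.
have E k := etrans (esym (step_level s1 k)) (step_level s2 k).
split; apply/eqP.
  by have := E u; rewrite eqxx (negbTE uv); case: (u == u') => //; case: (u == v'); lia.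
have := E v; rewrite eqxx [v == u]eq_sym (negbTE uv).
by case: (v == v') => //; case: (v == u'); lia.
Qed.

Lemma step_sym u v x y : step u v x y -> step v u y x.
Proof.
move=> [uv yu yv xy]; split; rewrite 1?eq_sym // => k kv ku.
by rewrite xy.
Qed.

(** The Busemann functions sum to zero at both ends of an edge, so the two
    changed coordinates move in opposite directions. *)
Lemma adj_step x y : e x y <-> exists u v, step u v x y.
Proof.
split=> [/existsP[i /existsP[j /and4P[ij + + /forallP xy]]]|[u [v [uv yu yv xy]]]].
  have {}xy k : k != i -> k != j -> val x k = val y k.
    by move=> ki kj; apply/eqP; have := xy k; rewrite ki kj.
  have := level_two ij xy; rewrite !tadjE => + /orP[/eqP xi|/eqP yi] /orP[/eqP xj|/eqP yj].
  - by rewrite -xi -xj !busemann_up; lia.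
  - by move=> _; exists i, j; split.
  - move=> _; exists j, i; split; rewrite 1?eq_sym // => k kj ki; exact: xy.
  - by rewrite -yi -yj !busemann_up; lia.
apply/existsP; exists u; apply/existsP; exists v; apply/and4P; split=> //.
- by rewrite tadjE yu eqxx.
- by rewrite tadjE yv eqxx orbT.
- by apply/forallP => k; apply/implyP => /andP[ku kv]; rewrite xy.
Qed.

Lemma DL_adj_sym : symmetric e.
Proof.
by move=> x y; apply/idP/idP => /adj_step[u [v /step_sym s]]; apply/adj_step; exists v, u.
Qed.

Lemma step_exists x u v (c : T v) : u != v -> up c = val x v ->
  exists y, step u v x y /\ val y v = c.
Proof.
move=> uv cx; have [|y [yu yv xy]] := @change_two x u v (up (val x u)) c uv.
  by rewrite -cx !busemann_up; lia.
by exists y; split=> //; split=> //; rewrite yv.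
Qed.

Lemma step_inj u v x y y' : step u v x y -> step u v x y' -> val y v = val y' v ->
  y = y'.
Proof.
move=> [uv yu yv xy] [_ yu' yv' xy'] E; apply: DL_ext => k.
have [->|ku] := eqVneq k u; first by rewrite yu yu'.
by have [->|kv] := eqVneq k v; last by rewrite -xy // xy'.
Qed.

(** The end of the edge of type t from x whose coordinate t.2 is the child c; the
    default value x is a dummy. *)
Definition step_to x (t : 'I_d * 'I_d) (c : T t.2) : DLV :=
  xget x [set y | step t.1 t.2 x y /\ val y t.2 = c]%classic.

Lemma step_toP x t (c : T t.2) : t.1 != t.2 -> up c = val x t.2 ->
  step t.1 t.2 x (step_to x c) /\ val (step_to x c) t.2 = c.
Proof.
move=> t12 cx; rewrite /step_to; case: xgetP => [//|no].
by have [y yP] := step_exists t12 cx; have := no y.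
Qed.

(** The neighbours of x along edges whose type lies in P. *)
Definition steps (P : {set 'I_d * 'I_d}) x : seq DLV :=
  [seq step_to x c | t <- enum P, c <- children (val x t.2)].

Lemma stepsP (P : {set 'I_d * 'I_d}) x : (forall t, t \in P -> t.1 != t.2) ->
  [/\ uniq (steps P x), size (steps P x) = (\sum_(t in P) q t.2)%N &
      forall y, y \in steps P x <-> exists2 t, t \in P & step t.1 t.2 x y].
Proof.
move=> Pd; split.
- apply: allpairs_uniq_dep; first exact: enum_uniq.
    by move=> t _; case: (childrenP (val x t.2)).
  move=> [t c] [t' c'] /allpairsPdep[s [b [sP bc /= E]]].
  move=> /allpairsPdep[s' [b' [sP' bc' /= E']]] /=.
  have [? ?] : s = t /\ s' = t' by split; [case: E|case: E'].
  subst s s'; rewrite !mem_enum in sP sP'.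
  have cb := eq_from_Tagged E; have cb' := eq_from_Tagged E'.
  rewrite /= in cb cb'; subst c c'.
  move: bc bc'; have [_ _ ->] := childrenP (val x t.2).
  have [_ _ ->] := childrenP (val x t'.2) => /eqP bt /eqP bt' EE.
  have [s1 v1] := step_toP (Pd _ sP) bt; have [s2 v2] := step_toP (Pd _ sP') bt'.
  rewrite -EE in s2 v2; have [t1 t2] := step_uniq s1 s2.
  have tt : t = t'.
    by case: t t' t1 t2 {E E' EE s1 v1 s2 v2 bt bt' sP sP' b b'}
      => [? ?] [? ?] /= -> ->.
  subst t'; by rewrite -v1 -v2.
- rewrite size_allpairs_dep sumnE big_map big_enum /=; apply: eq_bigr => t _.
  by case: (childrenP (val x t.2)).
move=> y; split=> [/allpairsPdep[t [c [tP + ->]]]|[t tP s]].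
  have [_ _ ->] := childrenP (val x t.2) => /eqP cx; rewrite mem_enum in tP.
  by exists t => //; have [] := step_toP (Pd _ tP) cx.
have yx : up (val y t.2) = val x t.2 by case: s.
apply/allpairsPdep; exists t, (val y t.2); rewrite mem_enum; split=> //.
  by have [_ _ ->] := childrenP (val x t.2); apply/eqP.
by have [s' v'] := step_toP (Pd _ tP) yx; exact: step_inj s s' (esym v').
Qed.

End DLsteps.

(** * Siblings and common neighbours *)
Section Siblings.
Variables (d : nat) (q : 'I_d -> nat) (T : forall i, ended_tree (q i)).
Local Notation DLV := (DL_vertex T).
Local Notation e := (@DL_adj d q T).
Local Notation h := (@busemann _ _).
Implicit Types (x y z : DLV) (u v k : 'I_d).

(** Siblings need not be distinct: every vertex is a sibling of itself. *)
Definition sibling x z : Prop := exists i,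
  up (val x i) = up (val z i) /\ forall k, k != i -> val x k = val z k.

Lemma sibling_level x z k : sibling x z -> h (val x k) = h (val z k).
Proof.
move=> [i [xz eq]]; have [->|ki] := eqVneq k i; last by rewrite eq.
have := congr1 h xz; rewrite !busemann_up; lia.
Qed.

Lemma sibling_nonadj x z : sibling x z -> ~ e x z.
Proof.
move=> xz /adj_step[u [v s]]; have := step_level s u; rewrite (sibling_level u xz).
by have [/negbTE uv _ _ _] := s; rewrite eqxx uv; lia.
Qed.

(** A common neighbour y of x and z that are neither siblings nor adjacent never
    undoes a move: both coordinates changed from x to y stay changed in z, for
    otherwise z would be equal to x, a sibling of x or adjacent to x.  Hence
    z_v lies below x_v in tree v, and y_v is the first vertex on the way down
    from x_v to z_v. *)
Lemma common_nbr_coords x z y u v u' v' : ~ sibling x z -> ~ e x z ->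
  step u v x y -> step u' v' z y ->
  [/\ val z u != val x u /\ (h (val z u) <= h (val x u))%R,
      (h (val x v) < h (val z v))%R &
      val y v = if h (val z v) == (h (val x v) + 1)%R then val z v
                else up (val z v)].
Proof.
move=> nsib nadj s s'; have [uv yu yv xy] := s; have [uv' yu' yv' zy] := s'.
have L k : (h (val z k) = h (val x k) + (k == v)%:Z - (k == u)%:Z
    - (k == v')%:Z + (k == u')%:Z)%R.
  move: (step_level s k) (step_level s' k).
  move: (h (val x k)) (h (val y k)) (h (val z k)) => a b c; clear; lia.
have zu : val z u != val x u.
  apply/eqP => zu; have := L u; rewrite zu eqxx (negbTE uv).
  have [euu' _|_] := eqVneq u u'; last first.
    by case: (u == v'); move: (h (val x u)) => a; clear; lia.
  rewrite -{u'}euu' in uv' yu' zy s' L *.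
  have [evv'|vv'] := eqVneq v v'.
    apply: nsib; exists u; split=> [|k ku]; first by rewrite zu.
    have [->|kv] := eqVneq k v; first by rewrite -yv evv' yv'.
    by rewrite xy // zy // -evv'.
  apply: nadj; apply/adj_step; exists v', v; split; rewrite 1?eq_sym //.
  - by rewrite -yv' xy // 1?eq_sym.
  - by rewrite zy // eq_sym.
  - move=> k kv' kv; have [->//|ku] := eqVneq k u.
    by rewrite xy // zy.
have zv : val z v != val x v.
  apply/eqP => zv; have := L v; rewrite zv eqxx [v == u]eq_sym (negbTE uv).
  have [evv' _|_] := eqVneq v v'; last first.
    by case: (v == u'); move: (h (val x v)) => a; clear; lia.
  rewrite -{v'}evv' in uv' yv' zy s' L *.
  have [euu'|uu'] := eqVneq u u'.
    apply: nsib; exists u; split=> [|k ku]; first by rewrite -yu euu'.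
    have [->//|kv] := eqVneq k v.
    by rewrite xy // zy // -euu'.
  apply: nadj; apply/adj_step; exists u, u'; split=> //.
  - by rewrite zy.
  - by rewrite -yu' xy // eq_sym.
  - move=> k ku ku'; have [->//|kv] := eqVneq k v.
    by rewrite xy // zy.
have vv' : v != v' by apply/eqP => vv'; case/eqP: zv; rewrite -yv vv' yv'.
split.
- split=> //; rewrite L eqxx (negbTE uv).
  by case: (u == v'); case: (u == u'); move: (h (val x u)) => a; clear; lia.
- rewrite L eqxx [v == u]eq_sym (negbTE uv) (negbTE vv').
  by case: (v == u'); move: (h (val x v)) => a; clear; lia.
rewrite L eqxx [v == u]eq_sym (negbTE uv) (negbTE vv').
have [->|vu'] := eqVneq v u'; move: (h _) => a.
  by rewrite yu'; case: eqP => //; clear; lia.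
by rewrite zy //; case: eqP => //; clear; lia.
Qed.

(** By [common_nbr_coords] a common neighbour is determined by the type (u, v) of
    its edge from x.  Here v ranges over the set D of the coordinates in which z
    has a larger Busemann value than x, and u over the set U of the other
    coordinates in which x and z differ.  Since |U| + |D| is at most 4 and at most
    d, the product |U| |D| is less than 2 (d - 1). *)
Lemma few_common_nbrs x z (s : seq DLV) : (2 <= d)%N -> ~ sibling x z -> ~ e x z ->
  uniq s -> (forall y, y \in s -> e x y /\ e z y) -> (size s < 2 * d.-1)%N.
Proof.
move=> d2 nsib nadj us sP; case: s us sP => [|y0 s0]; first by move=> _ _ /=; lia.
set s := y0 :: s0 => us sP.
pose U := [set k | (val z k != val x k) && (h (val z k) <= h (val x k))%R].
pose D := [set k | (h (val x k) < h (val z k))%R].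
(* The type of the edge from x to y, with a dummy value if there is none. *)
have typ y : exists t : 'I_d * 'I_d, e x y -> step t.1 t.2 x y.
  have [/adj_step[u [v uv]]|no] := pselect (e x y); first by exists (u, v).
  by exists (Ordinal d2, Ordinal d2) => /no.
pose f y := projT1 (cid (typ y)).
have fP y : y \in s -> step (f y).1 (f y).2 x y.
  by move=> /sP[xy _]; rewrite /f; case: (cid _) => t /= /(_ xy).
have coords y : y \in s -> _ := fun ys =>
  let: conj _ zy := sP y ys in let: ex_intro u' (ex_intro v' s') := (adj_step z y).1 zy in
  common_nbr_coords nsib nadj (fP y ys) s'.
have f_inj : {in s &, injective f}.
  move=> y y' ys ys' ff; have [_ _ yv] := coords y ys.
  have [_ _ yv'] := coords y' ys'; have sy := fP y ys; have sy' := fP y' ys'.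
  rewrite -ff in sy' yv'; apply: (step_inj sy sy'); by rewrite yv yv'.
have fs : (size s <= #|U| * #|D|)%N.
  rewrite -cardsX -(size_map f) cardE; apply: uniq_leq_size.
    by rewrite map_inj_in_uniq.
  move=> t /mapP[y ys ->]; have [[zu hu] hv _] := coords y ys.
  by rewrite mem_enum inE /= !inE zu hu hv.
have UD : #|U :|: D| = (#|U| + #|D|)%N.
  apply/eqP; rewrite (leq_card_setU U D); apply/pred0P => k /=; rewrite !inE.
  by apply/negP => /andP[/andP[_]]; lia.
have UDd : (#|U :|: D| <= d)%N by rewrite -[leqRHS]card_ord max_card.
have UD4 : (#|U :|: D| <= 4)%N.
  have ys : y0 \in s by rewrite inE eqxx.
  have [xy0 zy0] := sP _ ys.
  have [u [v [uv _ _ xy]]] := (adj_step x y0).1 xy0.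
  have [u' [v' [uv' _ _ zy]]] := (adj_step z y0).1 zy0.
  apply: leq_trans (_ : #|[set u; v] :|: [set u'; v']| <= 4)%N.
    apply/subset_leq_card/fintype.subsetP => k; rewrite !inE => UDk.
    apply: contraTT UDk; rewrite !negb_or => /andP[/andP[ku kv] /andP[ku' kv']].
    by rewrite xy // zy // eqxx Order.POrderTheory.ltxx.
  apply: leq_trans (_ : #|[set u; v]| + #|[set u'; v']| <= 4)%N.
    exact: leq_card_setU.
  by rewrite !cards2; case: (u != v); case: (u' != v').
rewrite UD in UDd UD4.
apply: leq_ltn_trans fs _; move: UDd UD4 d2; move: #|U| #|D| => a b; clear.
by case: a => [|[|[|[|[|a]]]]]; lia.
Qed.

Lemma sum_pair_ge (P : {set 'I_d * 'I_d}) : (forall i, 2 <= q i)%N ->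
  (2 * #|P| <= \sum_(t in P) q t.2)%N.
Proof. by move=> q2; rewrite mulnC -sum_nat_const; apply: leq_sum. Qed.

(** Siblings in tree i share the neighbours obtained by going up in tree i and down
    in any other tree, where there are at least two children to choose from. *)
Lemma many_common_nbrs x z : (forall i, 2 <= q i)%N -> sibling x z ->
  exists s : seq DLV, [/\ uniq s, size s = (2 * d.-1)%N &
    forall y, y \in s -> e x y /\ e z y].
Proof.
move=> q2 [i [xz eq]]; pose P := [set (i, j) | j in [set~ i]].
have PP t : t \in P -> t.1 = i /\ t.2 != i.
  by move=> /imsetP[j + ->]; rewrite !inE.
have Pd t : t \in P -> t.1 != t.2 by move=> /PP[->]; rewrite eq_sym.
have [us ss sP] := stepsP x Pd.
have cP : #|P| = d.-1.
  by rewrite card_imset ?cardsC1 ?card_ord // => j j' [].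
exists (take (2 * d.-1) (steps P x)); split.
- exact: take_uniq.
- by rewrite size_takel // ss -cP; exact: sum_pair_ge.
move=> y /mem_take /sP[[u v] uvP s]; split; first by apply/adj_step; exists u, v.
have [/= eu vi] := PP _ uvP; rewrite /= eu in s; case: s => iv yu yv xy.
apply/adj_step; exists i, v; split=> // [||k ki kv].
- by rewrite -xz.
- by rewrite yv eq.
- by rewrite -eq // xy.
Qed.

(** The siblings of x adjacent to y are the vertices reached from y by going down
    in tree u and back up in tree v. *)
Lemma sibling_nbrs x y u v : step u v x y ->
  exists s : seq DLV, [/\ uniq s, size s = q u &
    forall z, z \in s <-> sibling x z /\ e z y].
Proof.
move=> s; have [uv yu yv xy] := s.
have Pd t : t \in [set (v, u)] -> t.1 != t.2.
  by rewrite inE => /eqP -> /=; rewrite eq_sym.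
have [us ss sP] := stepsP y Pd.
exists (steps [set (v, u)] y); split=> //; first by rewrite ss big_set1.
move=> z; split=> [/sP[t]|[xz /adj_step[u' [v' s']]]].
  rewrite inE => /eqP -> /= /step_sym sz; split; last by apply/adj_step; exists u, v.
  have [_ yu' yv' zy] := sz; exists u; split=> [|k ku]; first by rewrite -yu.
  have [->|kv] := eqVneq k v; first by rewrite -yv -yv'.
  by rewrite xy // zy.
apply/sP; exists (v, u); rewrite ?inE //=; apply: step_sym.
have [u'v' _ _ _] := s'.
have L k : ((k == v)%:Z - (k == u)%:Z = (k == v')%:Z - (k == u')%:Z)%R.
  move: (step_level s k) (step_level s' k); rewrite (sibling_level k xz).
  by move: (h (val y k)) (h (val z k)) => a b; clear; lia.
have -> : u = u'.
  by have := L u; rewrite eqxx (negbTE uv); case: eqVneq => // _; case: eqVneq.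
have -> // : v = v'.
have := L v; rewrite eqxx [v == u]eq_sym (negbTE uv).
by case: (eqVneq v v') => // _; case: eqVneq.
Qed.

End Siblings.

(** * An invariant relation with different degrees *)
Section Twins.
Variables (V : choiceType) (e : rel V) (m : nat).

(** The description of siblings in terms of adjacency alone, with m standing for
    the number of common neighbours. *)
Definition twin (x z : V) : Prop := z = x \/ ~ e x z /\
  exists s : seq V, [/\ uniq s, size s = m & forall y, y \in s -> e x y /\ e z y].

Definition twins_ge n (x y : V) : Prop :=
  exists s : seq V, [/\ uniq s, size s = n & forall z, z \in s -> twin x z /\ e z y].

(** The number n separates two cardinals: at least n twins of y are adjacent to x,
    but fewer than n twins of x are adjacent to y. *)
Definition biased : rel V := fun x y =>
  e x y && `[< exists n, twins_ge n y x /\ ~ twins_ge n x y >].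

Lemma twin_iso f x z : is_graph_iso e e f -> twin x z -> twin (f x) (f z).
Proof.
move=> [/bij_inj fi fe] [->|[xz [s [us ss sP]]]]; [by left|right].
rewrite fe; split=> //; exists (map f s).
rewrite (map_inj_uniq fi) size_map; split=> // _ /mapP[y ys ->].
by rewrite !fe; exact: sP.
Qed.

Lemma twins_ge_iso f n x y : is_graph_iso e e f ->
  twins_ge n x y -> twins_ge n (f x) (f y).
Proof.
move=> fiso [s [us ss sP]]; have [/bij_inj fi fe] := fiso; exists (map f s).
rewrite (map_inj_uniq fi) size_map; split=> // _ /mapP[z zs ->].
by rewrite fe; have [xz zy] := sP _ zs; split=> //; exact: twin_iso.
Qed.

Lemma biased_iso f x y : is_graph_iso e e f -> biased x y -> biased (f x) (f y).
Proof.
move=> fiso /andP[xy /asboolP[n [yx nxy]]]; have [[g fK gK] fe] := fiso.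
rewrite /biased fe xy; apply/asboolP; exists n; split; first exact: twins_ge_iso.
have giso : is_graph_iso e e g.
  by split; [exists f | move=> a b; rewrite -fe !gK].
by move/(twins_ge_iso giso); rewrite !fK.
Qed.

End Twins.

Section Bias.
Variables (d : nat) (q : 'I_d -> nat) (T : forall i, ended_tree (q i)).
Local Notation DLV := (DL_vertex T).
Local Notation e := (@DL_adj d q T).
Implicit Types (x y z : DLV) (u v k : 'I_d).
Hypothesis d2 : (2 <= d)%N.
Hypothesis q2 : forall i, (2 <= q i)%N.

Lemma twin_sibling x z : twin e (2 * d.-1) x z <-> sibling x z.
Proof.
split=> [[->|[nxz [s [us ss sP]]]]|xz].
- by exists (Ordinal d2).
- apply: contrapT => nsib; have := few_common_nbrs d2 nsib nxz us sP.
  by rewrite ss ltnn.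
have [->|/eqP zx] := eqVneq z x; first by left.
right; split; first exact: sibling_nonadj.
exact: many_common_nbrs.
Qed.

Lemma twins_geE n x y u v : step u v x y ->
  twins_ge e (2 * d.-1) n x y <-> (n <= q u)%N.
Proof.
move=> /sibling_nbrs[s [us ss sP]]; split=> [[t [ut <- tP]]|nq].
  rewrite -ss; apply: uniq_leq_size => // z zt; have [xz zy] := tP _ zt.
  by apply/sP; split=> //; exact/twin_sibling.
exists (take n s); rewrite take_uniq // size_takel ?ss //; split=> // z /mem_take.
by move=> /sP[xz zy]; split=> //; exact/twin_sibling.
Qed.

Lemma biasedE x y : biased e (2 * d.-1) x y <->
  exists u v, step u v x y /\ (q u < q v)%N.
Proof.
split=> [/andP[/adj_step[u [v s]] /asboolP[n []]]|[u [v [s uv]]]].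
  rewrite (twins_geE n (step_sym s)) (twins_geE n s) => nv nu; exists u, v.
  by split=> //; apply: leq_trans nv; rewrite ltnNge; exact/negP.
apply/andP; split; first by apply/adj_step; exists u, v.
apply/asboolP; exists (q v); rewrite (twins_geE _ (step_sym s)) (twins_geE _ s).
by split=> //; apply/negP; rewrite -ltnNge.
Qed.

(** The out-degree of [biased] is the sum of q_v over the pairs with q_u < q_v, and
    its in-degree is the sum of q_u over the same pairs. *)
Lemma no_cofinite_action (G : groupType) (act : G -> DLV -> DLV) (H : {pred G})
    (L : seq DLV) (v0 : DLV) :
  (exists i j, q i != q j) ->
  (forall x, act 1%g x = x) ->
  (forall g h x, act (g * h)%g x = act g (act h x)) ->
  1%g \in H -> (forall g h, g \in H -> h \in H -> (g * h)%g \in H) ->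
  (forall g, g \in H -> (g^-1)%g \in H) ->
  (forall g x y, e (act g x) (act g y) = e x y) ->
  (forall x, exists s : seq G, forall g, g \in H -> act g x = x -> g \in s) ->
  (forall x, has (fun o => same_orbit act H o x) L) -> False.
Proof.
move=> [i [j ij]] act1 actM H1 HM HV acte fin cov.
pose stab (v : DLV) := [seq g <- undup (projT1 (cid (fin v))) | (g \in H) && (act g v == v)].
have stabP (v : DLV) g : (g \in stab v) = (g \in H) && (act g v == v).
  rewrite mem_filter mem_undup; case: (cid _) => s /= sP.
  by apply: andb_idr => /andP[Hg /eqP gv]; exact: sP.
have stabU (v : DLV) : uniq (stab v) by rewrite filter_uniq // undup_uniq.
pose P := [set t : 'I_d * 'I_d | (q t.1 < q t.2)%N].
pose Q := [set t : 'I_d * 'I_d | (q t.2 < q t.1)%N].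
have PE t : t \in P -> t.1 != t.2.
  by rewrite inE => qt; apply/eqP => t12; rewrite t12 ltnn in qt.
have QE t : t \in Q -> t.1 != t.2.
  by rewrite inE => qt; apply/eqP => t12; rewrite t12 ltnn in qt.
have := @mass_transport G DLV act H act1 actM H1 HM HV stab stabU stabP
  (biased e (2 * d.-1)) (steps P) (steps Q) (\sum_(t in P) q t.2)
  (\sum_(t in Q) q t.2) L v0.
move=> mt; have {mt} : (\sum_(t in P) q t.2 = \sum_(t in Q) q t.2)%N.
  apply: mt => //.
  - move=> g _ x y; apply: biased_iso; split; last exact: acte.
    exists (act g^-1%g) => v; first by rewrite -actM mulVg act1.
    by rewrite -actM mulgV act1.
  - move=> x; have [us ss sP] := stepsP x PE; split=> // y.
    apply/idP/idP => [/sP[[u v]]|/biasedE[u [v [s uv]]]].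
      by rewrite inE => uv s; apply/biasedE; exists u, v.
    by apply/sP; exists (u, v); rewrite ?inE.
  - move=> y; have [us ss sP] := stepsP y QE; split=> // x.
    apply/idP/idP => [/sP[[v u]]|/biasedE[u [v [s uv]]]].
      by rewrite inE => uv /step_sym s; apply/biasedE; exists u, v.
    by apply/sP; exists (v, u); rewrite ?inE //; exact: step_sym.
have -> : (\sum_(t in Q) q t.2 = \sum_(t in P) q t.1)%N.
  have swapI : involutive (fun t : 'I_d * 'I_d => (t.2, t.1)) by case.
  rewrite (reindex_inj (inv_inj swapI)) /=.
  by apply: eq_bigl => t; rewrite !inE.
apply/eqP; rewrite eq_sym neq_ltn; apply/orP; left.
have [t tP] : exists t, t \in P.
  move: ij; rewrite neq_ltn => /orP[] ij.
    by exists (i, j); rewrite inE.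
  by exists (j, i); rewrite inE.
rewrite (bigD1 t) //= [ltnRHS](bigD1 t) //= -addSn leq_add //.
  by rewrite inE in tP.
by apply: leq_sum => s /andP[]; rewrite inE => /ltnW.
Qed.

End Bias.

Section Connected.
Variables (d : nat) (q : 'I_d -> nat) (T : forall i, ended_tree (q i)).
Local Notation DLV := (DL_vertex T).
Local Notation e := (@DL_adj d q T).
Local Notation h := (@busemann _ _).
Implicit Types (x y z : DLV) (u v k : 'I_d).
Hypothesis d2 : (2 <= d)%N.
Hypothesis q2 : forall i, (2 <= q i)%N.

Definition linked x y := exists2 p, path e x p & last x p = y.

Lemma linked_refl x : linked x x. Proof. by exists [::]. Qed.

Lemma linked_trans x y z : linked x y -> linked y z -> linked x z.
Proof.
by move=> [p ep <-] [r er <-]; exists (p ++ r); rewrite ?last_cat // cat_path ep.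
Qed.

Lemma linked_adj x y : e x y -> linked x y.
Proof. by move=> xy; exists [:: y]; rewrite /= ?xy. Qed.

Lemma linked_sym x y : linked x y -> linked y x.
Proof.
move=> [p]; elim: p x => [|a p IHp] x /=; first by move=> _ ->; exact: linked_refl.
move=> /andP[xa ap] /(IHp _ ap) ya; apply: linked_trans ya _.
by apply: linked_adj; rewrite DL_adj_sym.
Qed.

Lemma child_exists u (a : T u) : exists c : T u, up c = a.
Proof.
have [_ sq mq] := childrenP a; have : (0 < size (children a))%N by rewrite sq ltnW.
by rewrite -has_predT => /hasP[c]; rewrite mq => /eqP; exists c.
Qed.

Lemma other_index u : exists v, v != u.
Proof.
have : (0 < #|[set~ u]|)%N by rewrite cardsC1 card_ord; lia.
by case/card_gt0P => v; rewrite !inE; exists v.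
Qed.

(** A path in tree u is followed step by step, each move being compensated in
    tree v. *)
Lemma linked_coord x u v (a : T u) : u != v -> exists y, [/\ linked x y,
  val y u = a & forall k, k != u -> k != v -> val y k = val x k].
Proof.
move=> uv; have [[_ _ /(_ (val x u) a)[p ep <-] _] _] := tadj_homogeneous (T u).
elim: p x ep => [|b p IHp] x /=; first by move=> _; exists x; split=> //; exact: linked_refl.
case/andP=> xb bp.
have [y [xy yb yk]] : exists y, [/\ linked x y, val y u = b &
    forall k, k != u -> k != v -> val y k = val x k].
  move: xb; rewrite tadjE => /orP[/eqP xb|/eqP bx].
    have [c cx] := child_exists (val x v).
    have [y [s _]] := step_exists uv cx; have [_ yu _ xy] := s; exists y.
    split; [|by rewrite yu|by move=> k ku kv; rewrite xy].
    by apply/linked_adj/adj_step; exists u, v.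
  have vu : v != u by rewrite eq_sym.
  have [y [s yb]] := step_exists vu bx; have [_ _ _ xy] := s; exists y.
  split=> // [|k ku kv]; last by rewrite xy.
  by apply/linked_adj/adj_step; exists v, u.
rewrite -yb in bp; have [z [yz zl zk]] := IHp y bp.
exists z; split; first exact: linked_trans xy yz.
  by rewrite zl yb.
by move=> k ku kv; rewrite zk // yk.
Qed.

(** Such x and y lie on one horocycle of tree u.  Going up in tree u, and down in
    another tree to the same vertex for both, brings them one step closer to
    their common ancestor. *)
Lemma linked_one x y u : (forall k, k != u -> val x k = val y k) -> linked x y.
Proof.
move=> xy; have [n xyn] := up_meet_level (level_one xy).
elim: n x y xy xyn => [|n IHn] x y xy xyn.
  suff -> : x = y by exact: linked_refl.
  by apply: DL_ext => k; have [->|/xy] := eqVneq k u.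
have [v vu] := other_index u; have uv : u != v by rewrite eq_sym.
have [c cx] := child_exists (val x v); have cy : up c = val y v by rewrite -xy.
have [x' [sx x'c]] := step_exists uv cx; have [y' [sy y'c]] := step_exists uv cy.
have xx' : linked x x' by apply/linked_adj/adj_step; exists u, v.
have yy' : linked y y' by apply/linked_adj/adj_step; exists u, v.
apply: linked_trans xx' (linked_trans _ (linked_sym yy')).
have [_ xu _ xk] := sx; have [_ yu _ yk] := sy.
apply: IHn; last by rewrite xu yu -!iterSr.
move=> k ku; have [->|kv] := eqVneq k v; first by rewrite x'c y'c.
by rewrite -xk // -yk // xy.
Qed.

(** All coordinates but one are corrected by [linked_coord], at the expense of the
    remaining one, which [linked_one] then repairs. *)
Lemma DL_connected x y : linked x y.
Proof.
have d0 : (0 < d)%N by lia.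
pose v := Ordinal d0.
suff H (s : seq 'I_d) : uniq s -> v \notin s ->
    exists z, linked x z /\ forall k, k \in s -> val z k = val y k.
  have [||z [xz zy]] := H (enum [set~ v]); first exact: enum_uniq.
    by rewrite mem_enum !inE eqxx.
  apply: linked_trans xz _; apply: (@linked_one _ _ v) => k kv.
  by apply: zy; rewrite mem_enum !inE.
elim: s => [|u s IHs] /=; first by exists x; split=> //; exact: linked_refl.
rewrite inE negb_or => /andP[us uns] /andP[vu vs].
have [z [xz zy]] := IHs uns vs; have uv : u != v by rewrite eq_sym.
have [z' [zz' z'u z'k]] := linked_coord z (val y u) uv.
exists z'; split=> [|k]; first exact: linked_trans xz zz'.
rewrite inE => /orP[/eqP -> //|ks]; rewrite z'k ?zy //.
  by apply: contraNneq us => <-.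
by apply: contraNneq vs => <-.
Qed.

Lemma ball_finite x n : exists s : seq DLV,
  forall p, path e x p -> size p = n -> last x p \in s.
Proof.
elim: n x => [|n IHn] x; first by exists [:: x] => -[|//] _ _; rewrite inE.
pose P := [set t : 'I_d * 'I_d | t.1 != t.2].
have PP t : t \in P -> t.1 != t.2 by rewrite inE.
have [_ _ sP] := stepsP x PP.
exists (flatten [seq projT1 (cid (IHn y)) | y <- steps P x]) => -[//|y p] /=.
move=> /andP[/adj_step[u [v s]] yp] [sp]; apply/flatten_mapP; exists y.
  by apply/sP; exists (u, v) => //; rewrite inE; case: s.
by case: (cid _) => t /= tP; exact: tP.
Qed.

End Connected.

(** * Transitivity of the automorphism group *)
Section Labels.
Variables (q : nat) (T : ended_tree q).
Implicit Types x y t u : T.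

Definition on_ray x : pred T := fun c => `[< exists n, c = iter n up x >].

(** The children of u, a child on the ray from x coming first. *)
Definition ranked x u : seq T :=
  [seq c <- children u | on_ray x c] ++ [seq c <- children u | ~~ on_ray x c].

Lemma rankedP x u : [/\ uniq (ranked x u), size (ranked x u) = q &
  forall t, (t \in ranked x u) = (up t == u)].
Proof.
have [uc sc mc] := childrenP u; have pc : perm_eq (ranked x u) (children u).
  by rewrite /ranked perm_filterC.
by rewrite (perm_uniq pc) (perm_size pc); split=> // t; rewrite (perm_mem pc).
Qed.

(** Every vertex gets a label below q that tells it from its siblings and is 0 all
    along the ray from x.  A vertex is then determined by its level and the labels
    of its iterated predecessors, and every eventually vanishing sequence of labels
    occurs: relative to x the tree becomes a standard one. *)
Definition label x t : nat := index t (ranked x (up t)).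

Lemma label_inj x t t' : up t = up t' -> label x t = label x t' -> t = t'.
Proof.
move=> tt'; rewrite /label tt'; have [_ _ mr] := rankedP x (up t') => tl.
rewrite -[t](@nth_index _ t t (ranked x (up t'))) ?mr ?tt' // tl nth_index //.
by rewrite mr.
Qed.

Lemma label_lt x t : (label x t < q)%N.
Proof.
by have [_ sr mr] := rankedP x (up t); rewrite -[X in (_ < X)%N]sr index_mem mr.
Qed.

Lemma label_surj x u k : (k < q)%N -> exists t, up t = u /\ label x t = k.
Proof.
have [ur sr mr] := rankedP x u; rewrite -[X in (_ < X)%N]sr => kq; exists (nth u (ranked x u) k).
have ut : up (nth u (ranked x u) k) = u by apply/eqP; rewrite -mr mem_nth.
by split=> //; rewrite /label ut index_uniq.
Qed.

Lemma label_ray x n : label x (iter n up x) = 0%N.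
Proof.
rewrite /label /ranked; set t := iter n up x; set F := [seq c <- _ | _].
have tF : t \in F.
  rewrite mem_filter; have [_ _ ->] := childrenP (up t).
  by rewrite eqxx andbT; apply/asboolP; exists n.
rewrite index_cat tF; case FE: F tF => [//|c F'] _ /=.
suff -> : c = t by rewrite eqxx.
have : c \in F by rewrite FE inE eqxx.
rewrite mem_filter; have [_ _ ->] := childrenP (up t).
move=> /andP[/asboolP[m ->] /eqP]; rewrite -!iterS => /iter_up_inj [->].
by [].
Qed.

(** The labels along the descent from u can be prescribed. *)
Lemma descend x u (g : nat -> nat) m : (forall i, (g i < q)%N) ->
  exists t, iter m up t = u /\ forall i, (i < m)%N -> label x (iter i up t) = g i.
Proof.
elim: m g => [|m IHm] g gq; first by exists u.
have [t1 [t1u t1g]] := IHm (fun i => g i.+1) (fun i => gq i.+1).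
have [t [tt1 tg]] := label_surj x t1 (gq 0).
exists t; rewrite iterSr tt1; split=> // -[//|i im].
by rewrite iterSr tt1 t1g.
Qed.

(** The vertices t and t' have the same coordinates in the standard labellings
    based at x and at y. *)
Definition same_place x y t t' : Prop :=
  (busemann t' - busemann y = busemann t - busemann x)%R /\
  forall n, label y (iter n up t') = label x (iter n up t).

(** From the ancestor of y that corresponds to a common ancestor of t and x one
    descends with the labels of t; further up all labels are 0. *)
Lemma same_place_exists x y t : exists t', same_place x y t t'.
Proof.
have [m [n mn]] := up_meet t x.
have [t' [t'y t'l]] := @descend y (iter n up y) (fun i => label x (iter i up t)) m
  (fun i => label_lt x _).
exists t'; split=> [|i].
  have := congr1 (@busemann q T) mn; have := congr1 (@busemann q T) t'y.
  rewrite !busemann_iter.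
  move: (busemann t') (busemann y) (busemann t) (busemann x) => a b c f; clear; lia.
have [im|mi] := ltnP i m; first exact: t'l.
by rewrite -(subnK mi) !iterD t'y mn -!iterD !label_ray.
Qed.

(** The two vertices lie on one level, so they have a common ancestor, from which
    equal labels lead down to equal vertices. *)
Lemma same_place_uniq x y t t1 t2 : same_place x y t t1 -> same_place x y t t2 -> t1 = t2.
Proof.
move=> [h1 l1] [h2 l2].
have [|n t12] := @up_meet_level _ T t1 t2.
  by apply: (GRing.addIr (- busemann y)%R); rewrite h1 h2.
elim: n t12 => [//|n IHn] t12; apply: IHn; apply: (@label_inj y); first by rewrite -!iterS.
by rewrite l1 l2.
Qed.

Lemma same_place_sym x y t t' : same_place x y t t' -> same_place y x t' t.
Proof. by move=> [ht lt]; split. Qed.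

Lemma same_place_up x y t t' : same_place x y t t' -> same_place x y (up t) (up t').
Proof.
move=> [ht lt]; split=> [|n]; last by rewrite -!iterSr.
by rewrite !busemann_up -GRing.addrA [(_ - busemann y)%R]GRing.addrC GRing.addrA ht
  -GRing.addrA [(- busemann x - 1)%R]GRing.addrC GRing.addrA.
Qed.

Lemma same_place_base x y : same_place x y x y.
Proof. by split=> [|n]; rewrite ?GRing.subrr ?label_ray. Qed.

Lemma tree_shift x y : exists f : T -> T, [/\ bijective f, f x = y,
  forall t, f (up t) = up (f t) &
  forall t, (busemann (f t) - busemann y = busemann t - busemann x)%R].
Proof.
pose f t := projT1 (cid (same_place_exists x y t)).
pose g t := projT1 (cid (same_place_exists y x t)).
have fP t : same_place x y t (f t) by rewrite /f; case: (cid _).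
have gP t : same_place y x t (g t) by rewrite /g; case: (cid _).
exists f; split=> [||t|t].
- exists g => t; first exact: same_place_uniq (gP _) (same_place_sym (fP t)).
  exact: same_place_uniq (fP _) (same_place_sym (gP t)).
- exact: same_place_uniq (fP x) (same_place_base x y).
- exact: same_place_uniq (fP _) (same_place_up (fP t)).
- by have [] := fP t.
Qed.

End Labels.

Section Transitive.
Variables (d : nat) (q : 'I_d -> nat) (T : forall i, ended_tree (q i)).
Local Notation DLV := (DL_vertex T).
Local Notation e := (@DL_adj d q T).
Local Notation h := (@busemann _ _).
Implicit Types (x y z : DLV) (u v k : 'I_d).

(** In each tree x_k is sent to y_k by an automorphism that adds the constant
    h(y_k) - h(x_k) to the Busemann function h.  These constants sum to zero, so
    the product of the automorphisms preserves DL. *)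
Lemma DL_transitive x y : exists f : graph_aut e, val f x = y.
Proof.
pose F k := projT1 (cid (tree_shift (val x k) (val y k))).
have FP k : [/\ bijective (F k), F k (val x k) = val y k,
    forall t, F k (up t) = up (F k t) &
    forall t, (h (F k t) - h (val y k) = h t - h (val x k))%R].
  by rewrite /F; case: (cid _).
have lev z : (\sum_k h (F k (val z k)) = 0)%R.
  rewrite (eq_bigr (fun k => h (val z k) - h (val x k) + h (val y k))%R); last first.
    by move=> k _; have [_ _ _ <-] := FP k; rewrite GRing.subrK.
  by rewrite big_split /= GRing.sumrB !DL_level GRing.subrr.
pose f z := projT1 (cid (DL_make (lev z))).
have fE z k : val (f z) k = F k (val z k) by rewrite /f; case: (cid _).
have G k : {g : T k -> T k | cancel (F k) g /\ cancel g (F k)}.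
  by apply: cid; have [[g gK Kg] _ _ _] := FP k; exists g.
have fstep z w u v : step u v z w <-> step u v (f z) (f w).
  have Fi k : injective (F k) by have [/bij_inj] := FP k.
  have FU k t : F k (up t) = up (F k t) by have [_ _ ->] := FP k.
  split=> -[uv wu wv zw]; split=> //.
  - by rewrite !fE wu FU.
  - by rewrite !fE -wv FU.
  - by move=> k ku kv; rewrite !fE zw.
  - by apply: (Fi u); rewrite FU -!fE.
  - by apply: (Fi v); rewrite FU -!fE.
  - by move=> k ku kv; apply: (Fi k); rewrite -!fE zw.
have glev z : (\sum_k h (projT1 (G k) (val z k)) = 0)%R.
  rewrite (eq_bigr (fun k => h (val z k) - h (val y k) + h (val x k))%R); last first.
    move=> k _; case: (G k) => g [gK Kg] /=; have [_ _ _ H] := FP k.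
    by have := H (g (val z k)); rewrite Kg => ->; rewrite GRing.subrK.
  by rewrite big_split /= GRing.sumrB !DL_level GRing.subrr.
pose g z := projT1 (cid (DL_make (glev z))).
have gE z k : val (g z) k = projT1 (G k) (val z k) by rewrite /g; case: (cid _).
have fiso : `[< is_graph_iso e e f >].
  apply/asboolP; split.
    exists g => z; apply: DL_ext => k; rewrite !(gE, fE); by case: (G k) => w [].
  move=> z w; apply/idP/idP => /adj_step[u [v s]]; apply/adj_step; exists u, v.
    exact/(fstep z w).
  exact/(fstep z w u v).
exists (exist _ f fiso); apply: DL_ext => k; rewrite /= fE; by have [_ ->] := FP k.
Qed.

Lemma DL_inhabited : exists x : DLV, True.
Proof.
have [|x _] := @DL_make _ _ T (fun i => origin (T i)); last by exists x.
by rewrite big1 // => i _; rewrite busemann_origin.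
Qed.

End Transitive.

(** * Discreteness and co-compactness in the group of automorphisms *)
Section Lattice.
Local Open Scope classical_set_scope.
Local Open Scope quotient_scope.
Variables (V : choiceType) (e : rel V) (H : groupClosed (graph_aut e)).

(** The filter of the properties that hold of all sufficiently large finite sets
    of vertices, each set being listed. *)
Definition eventually_list : set_system (seq V) :=
  fun A => exists L0 : seq V, forall L : seq V, {subset L0 <= L} -> A L.

#[local] Instance eventually_list_filter : Filter eventually_list.
Proof.
split.
- by exists [::].
- move=> A B [L LA] [M MB]; exists (L ++ M) => N sub.
  by split; [apply: LA|apply: MB] => x xs; apply: sub; rewrite mem_cat xs ?orbT.
- by move=> A B AB [L LA]; exists L => N /LA /AB.
Qed.

Definition fixing (L : seq V) : set (V -> V) := [set f | forall v, v \in L -> f v = v].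

(** The filter generated by the pointwise stabilizers of finite sets.  It converges
    to the identity, so every neighbourhood of the identity contains such a
    stabilizer. *)
Definition near_id : set_system (V -> V) :=
  fun A => exists L, fixing L `<=` A.

#[local] Instance near_id_filter : Filter near_id.
Proof.
split.
- by exists [::].
- move=> A B [L LA] [M MB]; exists (L ++ M) => f fLM.
  by split; [apply: LA|apply: MB] => x xs; apply: fLM; rewrite mem_cat xs ?orbT.
- by move=> A B AB [L LA]; exists L => N /LA /AB.
Qed.

Lemma near_id_cvg : near_id --> (id : {ptws V -> discrete_topology V}).
Proof.
apply/cvg_sup => v A [B [[C oC <-] Cv] BA].
by exists [:: v] => f fv; apply: BA; rewrite /= fv // inE.
Qed.

(** The identity is isolated in H, and a neighbourhood of it that meets H in no
    other element contains the pointwise stabilizer of a finite set L. *)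
Lemma discrete_subgroup_fixing : discrete_subgroup H ->
  exists L : seq V, forall g : graph_aut e, g \in H ->
    (forall v, v \in L -> val g v = v) -> g = 1%g.
Proof.
move=> disc.
have H1 : (1%g : graph_aut e) \in [set` H] by rewrite mem_setE gpred1.
pose e1 : set_type [set` H] := exist _ 1%g H1.
have [C' [C oC CC'] C1] := disc [set e1].
have : nbhs (id : {ptws V -> discrete_topology V}) C.
  apply: open_nbhs_nbhs; split=> //.
  have : (set_val @^-1` C')%classic e1 by rewrite C1.
  by rewrite /= -CC'.
move=> /near_id_cvg [L LC]; exists L => g gH gL.
have gH' : g \in [set` H] by rewrite mem_setE.
pose eg : set_type [set` H] := exist _ g gH'.
have : [set e1]%classic eg by rewrite -C1 /= -CC'; exact: LC.
by move=> /(congr1 val).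
Qed.

Lemma stabilizer_coset_open (v w : V) : open [set g : graph_aut e | val g v = w].
Proof.
exists [set f : {ptws V -> discrete_topology V} | f v = w] => //.
have : continuous (fun f : {ptws V -> discrete_topology V} => f v) by exact: proj_continuous.
move=> /continuousP /(_ [set w]); apply; exact: discrete_open.
Qed.

Lemma graph_autKV (g : graph_aut e) v : val g (val g^-1%g v) = v.
Proof. by have [_] := graph_aut_invK g; exact. Qed.

Lemma graph_autK (g : graph_aut e) v : val g^-1%g (val g v) = v.
Proof. by have [+ _] := graph_aut_invK g; exact. Qed.

(** For a vertex v let U v be the set of the cosets gH such that the inverse of g
    maps o into the H-orbit of v.  These sets are open and cover the factor space,
    so finitely many of them suffice. *)
Lemma cocompact_orbits (o : V) : compact [set: factor_space H] ->
  exists L : seq V, forall g : graph_aut e,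
    exists2 h, h \in H & exists2 v, v \in L & val h v = val g o.
Proof.
move=> /compact_near_coveringP cov.
pose pi_ (g : graph_aut e) : factor_space H := \pi_(lcosets H)%qT g.
have piP g g' : pi_ g = pi_ g' -> (g^-1 * g')%g \in H by move/eqmodP.
pose U v := [set c : factor_space H | exists2 g : graph_aut e, c = pi_ g &
  exists2 h, h \in H & val h v = val g^-1%g o].
have U_open v : open (U v).
  suff -> : open (U v) = open (\bigcup_(h in [set h : graph_aut e | h \in H])
      [set g : graph_aut e | val g (val h v) = o]).
    by apply: bigcup_open => h _; exact: stabilizer_coset_open.
  change (open (pi_ @^-1` U v) = open (\bigcup_(h in [set h : graph_aut e | h \in H])
      [set g : graph_aut e | val g (val h v) = o])).
  congr open; apply/seteqP; split=> [g [g' gg' [h Hh hv]]|g [h Hh gh]].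
    exists (g^-1 * g' * h)%g; first by rewrite /= gpredM // piP.
    by rewrite /= graph_autKV hv graph_autKV.
  by exists g => //; exists h => //; rewrite -gh graph_autK.
pose P (L : seq V) (c : factor_space H) := exists2 v, v \in L & U v c.
have [c _|L0 L0P] := cov _ eventually_list P _.
- pose g : graph_aut e := repr (c : lcosets H).
  have cg : c = pi_ g by rewrite /pi_ reprK.
  pose v := val g^-1%g o.
  have Uc : U v c by exists g => //; exists 1%g; rewrite ?gpred1.
  exists (U v, [set L : seq V | v \in L]).
    split; first exact: (open_nbhs_nbhs (conj (U_open v) Uc)).
    by exists [:: v] => L; apply; rewrite inE.
  by move=> [c' L] [/= Uc' vL]; exists v.
exists L0 => g; have [v vL [g' gg' [h Hh hv]]] := L0P _ (fun _ H => H) (pi_ g^-1%g) I.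
exists (g^-1^-1 * g' * h)%g; first by rewrite gpredM // piP.
by exists v => //; rewrite /= hv graph_autKV -[in RHS](invgK g).
Qed.

End Lattice.

(** * Finite stabilizers and the theorem *)
Section FiniteStabilizers.
Variables (V : choiceType) (e : rel V) (H : groupClosed (graph_aut e)).

(** Induction on L: for each of the finitely many values at the head of L, the
    elements of A with that value are finite in number. *)
Lemma finite_by_values (L : seq V) (A : graph_aut e -> Prop) :
  (forall w, w \in L -> exists b : seq V, forall g, A g -> val g w \in b) ->
  (forall g g', A g -> A g' -> (forall w, w \in L -> val g w = val g' w) -> g = g') ->
  exists s : seq (graph_aut e), forall g, A g -> g \in s.
Proof.
elim: L A => [|w L IHL] A vals inj.
  have [[g0 Ag0]|no] := pselect (exists g, A g); last first.
    by exists [::] => g Ag; case: no; exists g.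
  by exists [:: g0] => g Ag; rewrite inE; apply/eqP/inj.
have [b bP] := vals w (mem_head _ _).
have fib a : exists s : seq (graph_aut e), forall g, A g -> val g w = a -> g \in s.
  have [|g g' [Ag ga] [Ag' g'a] gg'|s sP] := IHL (fun g => A g /\ val g w = a).
  - move=> u uL; have [c cP] := vals u (@mem_behead _ (w :: L) u uL).
    by exists c => g [/cP].
  - apply: inj => // u; rewrite inE => /orP[/eqP ->|]; first by rewrite ga g'a.
    exact: gg'.
  - by exists s => g Ag ga; exact: sP.
exists (flatten [seq projT1 (cid (fib a)) | a <- b]) => g Ag.
apply/flatten_mapP; exists (val g w); first exact: bP.
by case: (cid _) => s /= sP; exact: sP.
Qed.

(** An element of H fixing x preserves the balls around x, hence takes finitely
    many values on the finite set L of [discrete_subgroup_fixing]; and it is determined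
    by these values, because only the identity of H fixes L pointwise. *)
Lemma discrete_finite_stabilizer x : discrete_subgroup H -> connected_graph e ->
  (forall n, exists s : seq V, forall p, path e x p -> size p = n -> last x p \in s) ->
  exists s : seq (graph_aut e), forall g, g \in H -> val g x = x -> g \in s.
Proof.
move=> disc conn ball; have [L LP] := discrete_subgroup_fixing disc.
have [w wL|g g' [gH _] [g'H _] gg'|s sP] :=
  @finite_by_values L (fun g => g \in H /\ val g x = x).
- have [p xp pw] := conn x w; have [s sP] := ball (size p).
  exists s => g [_ gx]; rewrite -pw -last_map gx; apply: sP; last exact: size_map.
  rewrite -{1}gx; apply: homo_path xp => a b ab.
  by have [_ ->] := graph_autP g.
- apply: (@mulgI _ g^-1%g); rewrite mulVg; apply/esym/LP.
    by rewrite gpredM ?gpredV.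
  by move=> w wL; change (val g^-1%g (val g' w) = w); rewrite -gg' // graph_autK.
- by exists s => g gH gx; exact: sP.
Qed.

End FiniteStabilizers.

Theorem mainTheorem3 (d : nat) (q : 'I_d -> nat)
    (T : forall i : 'I_d, ended_tree (q i)) :
  2 <= d ->
  (forall i, 2 <= q i) ->
  (exists i j, q i != q j) ->
  (forall Gamma : groupClosed (graph_aut (@DL_adj d q T)),
      ~ cocompact_lattice Gamma) /\
  (forall (G : groupType) (S : {fset G}),
      symmetric_subset S -> generates S ->
      ~ isomorphic_graphs (@DL_adj d q T) (cayley_adj S)).
Proof.
move=> d2 q2 qij; have [o _] := DL_inhabited T; split.
  move=> Gamma [disc _ /(cocompact_orbits o)[L LP]].
  apply: (@no_cofinite_action d q T d2 q2 (graph_aut (@DL_adj d q T))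
    (fun g => val g) (mem Gamma) L o) => //.
  - exact: gpred1.
  - by move=> g h; exact: gpredM.
  - by move=> g gG; have : g^-1%g \in Gamma by rewrite gpredV.
  - by move=> g x y; have [_ gm] := graph_autP g; exact: gm.
  - move=> x; apply: discrete_finite_stabilizer => // [u v|n].
      exact: (DL_connected d2 q2).
    exact: ball_finite.
  - move=> x; have [f <-] := DL_transitive o x; have [h hG [v vL hv]] := LP f.
    by apply/hasP; exists v => //; apply/asboolP; exists h.
move=> G S _ _ [f [[g fK gK] fe]].
pose act (a : G) v := g (a * f v)%g.
apply: (@no_cofinite_action d q T d2 q2 G act xpredT [:: o] o) => //.
- by move=> x; rewrite /act mul1g fK.
- by move=> a b x; rewrite /act gK mulgA.
- by move=> a x y; rewrite -!fe /act !gK /cayley_adj invgM -mulgA mulKg.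
- move=> x; exists [:: 1%g] => a _ /(congr1 f); rewrite /act gK => ax.
  by rewrite inE; apply/eqP/(@mulIg _ (f x)); rewrite ax mul1g.
- move=> x; rewrite /= orbF; apply/asboolP; exists (f x * (f o)^-1)%g => //.
  by rewrite /act mulgVK fK.
Qed.
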